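(* Let $(!, \delta, \varepsilon, \partial)$ be a Cartesian differential comonad on a category $\mathbb{X}$ with finite biproducts. Then $\mathbb{X}_!$ is a Cartesian differential abstract coKleisli category with Cartesian differential structure given by the canonical Cartesian left additive structure of $\mathbb{X}_!$ together with the differential combinator $[\![\mathsf{D}[f]]\!]=[\![f]\!]\circ\partial_A$ for $[\![f]\!]:!(A)\to B$, and with the canonical abstract coKleisli structure $(!_!, \varphi, \epsilon)$ of $\mathbb{X}_!$.
   Context: Composition is in classical order: $g \circ f$ means first $f$, then $g$. In a category with (chosen) finite products, $\pi_0,\pi_1$ are the projections of $A\times B$, $\langle f,g\rangle$ is pairing, $h\times k=\langle h\circ\pi_0,k\circ\pi_1\rangle$, and $\top$ is the terminal object. Cartesian left additive categories. A left additive category is a category whose hom-sets are commutative monoids (with $+$ and $0$) such that $(f+g)\circ x=f\circ x+g\circ x$ and $0\circ x=0$. A map $f$ is additive if $f\circ(x+y)=f\circ x+f\circ y$ and $f\circ 0=0$. A Cartesian left additive category is a left additive category with finite products in which all projections are additive. A category with finite biproducts is regarded as a Cartesian left additive category (in which every map is additive). In a Cartesian left additive category define $\iota_0=\langle 1_A,0\rangle: A\to A\times B$, $\iota_1=\langle 0,1_B\rangle: B\to A\times B$, $\nabla_A=\pi_0+\pi_1: A\times A\to A$, $\ell_A=\iota_0\times\iota_1: A\times A\to (A\times A)\times(A\times A)$, $c_A=\langle\pi_0\times\pi_0,\pi_1\times\pi_1\rangle:(A\times A)\times(A\times A)\to(A\times A)\times(A\times A)$. Cartesian differential categories. A differential combinator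 on a Cartesian left additive category is a family of operators sending $f:A\to B$ to $\mathsf{D}[f]:A\times A\to B$ with: [CD.1] $\mathsf{D}[f+g]=\mathsf{D}[f]+\mathsf{D}[g]$, $\mathsf{D}[0]=0$; [CD.2] $\mathsf{D}[f]\circ(1_A\times\nabla_A)=\mathsf{D}[f]\circ(1_A\times\pi_0)+\mathsf{D}[f]\circ(1_A\times\pi_1)$, $\mathsf{D}[f]\circ\iota_0=0$; [CD.3] $\mathsf{D}[1_A]=\pi_1$, $\mathsf{D}[\pi_0]=\pi_0\circ\pi_1$, $\mathsf{D}[\pi_1]=\pi_1\circ\pi_1$; [CD.4] $\mathsf{D}[\langle f,g\rangle]=\langle\mathsf{D}[f],\mathsf{D}[g]\rangle$; [CD.5] $\mathsf{D}[g\circ f]=\mathsf{D}[g]\circ\langle f\circ\pi_0,\mathsf{D}[f]\rangle$; [CD.6] $\mathsf{D}[\mathsf{D}[f]]\circ\ell_A=\mathsf{D}[f]$; [CD.7] $\mathsf{D}[\mathsf{D}[f]]\circ c_A=\mathsf{D}[\mathsf{D}[f]]$. A Cartesian differential category is a Cartesian left additive category with a differential combinator. A map $f$ is $\mathsf{D}$-linear if $\mathsf{D}[f]=f\circ\pi_1$. Abstract coKleisli categories. An abstract coKleisli structure on a category $\mathbb{Y}$ is a triple $(!,\varphi,\epsilon)$ with an endofunctor $!:\mathbb{Y}\to\mathbb{Y}$, a natural transformation $\varphi_A:A\to !(A)$, and a family of maps $\epsilon_A:!(A)\to A$ (not necessarily natural) such that $\epsilon_{!(A)}:!!(A)\to !(A)$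 is natural in $A$ and $\epsilon_A\circ\varphi_A=1_A$, $\epsilon_{!(A)}\circ !(\varphi_A)=1_{!(A)}$, $\epsilon_A\circ\epsilon_{!(A)}=\epsilon_A\circ !(\epsilon_A)$. A map $f:A\to B$ is $\epsilon$-natural if $\epsilon_B\circ !(f)=f\circ\epsilon_A$. A Cartesian left additive abstract coKleisli category is a Cartesian left additive category with an abstract coKleisli structure such that all projections $\pi_0,\pi_1$ are $\epsilon$-natural, zero maps are $\epsilon$-natural, and the sum of two parallel $\epsilon$-natural maps is $\epsilon$-natural. A Cartesian differential abstract coKleisli category is a Cartesian left additive abstract coKleisli category which is also a Cartesian differential category and in which every $\epsilon$-natural map is $\mathsf{D}$-linear. coKleisli categories. For a comonad $(!,\delta,\varepsilon)$ on $\mathbb{X}$ ($\delta_A:!(A)\to !!(A)$, $\varepsilon_A:!(A)\to A$), the coKleisli category $\mathbb{X}_!$ has the objects of $\mathbb{X}$, and a map $f:A\to B$ in $\mathbb{X}_!$ is a map $[\![f]\!]:!(A)\to B$ in $\mathbb{X}$; $[\![g\circ f]\!]=[\![g]\!]\circ !([\![f]\!])\circ\delta_A$, $[\![1_A]\!]=\varepsilon_A$. If $\mathbb{X}$ is Cartesian left additive, the canonical Cartesian left additive structure of $\mathbb{X}_!$ is: products on objects and $\top$ as in $\mathbb{X}$, $[\![\pi_j]\!]=\pi_j\circ\varepsilon_{A\times B}$, $[\![\langle f,g\rangle]\!]=\langle[\![f]\!],[\![g]\!]\rangle$, $[\![f+g]\!]=[\![f]\!]+[\![g]\!]$, $[\![0]\!]=0$.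 The canonical abstract coKleisli structure $(!_!,\varphi,\epsilon)$ on $\mathbb{X}_!$ is: $!_!(A)=!(A)$, $[\![!_!(f)]\!]=!([\![f]\!])\circ\delta_A\circ\varepsilon_{!(A)}$, $[\![\varphi_A]\!]=1_{!(A)}$, and $[\![\epsilon_A]\!]=\varepsilon_A\circ\varepsilon_{!(A)}$. Cartesian differential comonads. For a comonad $(!,\delta,\varepsilon)$ on a category with finite biproducts, a differential combinator transformation is a natural transformation $\partial_A:!(A\times A)\to !(A)$ with: [dc.1] $\partial_A\circ !(\iota_0)=0$; [dc.2] $\partial_A\circ !(1_A\times\nabla_A)=\partial_A\circ(!(1_A\times\pi_0)+!(1_A\times\pi_1))$; [dc.3] $\varepsilon_A\circ\partial_A=\pi_1\circ\varepsilon_{A\times A}$; [dc.4] $\delta_A\circ\partial_A=\partial_{!(A)}\circ !(\langle !(\pi_0),\partial_A\rangle)\circ\delta_{A\times A}$; [dc.5] $\partial_A\circ\partial_{A\times A}\circ !(\ell_A)=\partial_A$; [dc.6] $\partial_A\circ\partial_{A\times A}\circ !(c_A)=\partial_A\circ\partial_{A\times A}$. A Cartesian differential comonad is a quadruple $(!,\delta,\varepsilon,\partial)$ of a comonad on a category with finite biproducts and a differential combinator transformation. *)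

(* Defs.v *)
From mathcomp Require Import ssreflect.

Set Implicit Arguments.
Unset Strict Implicit.
Unset Printing Implicit Defensive.

(* Structures are split into data (a record or class of operations) and a
   Prop-valued record [is_...] stating the axioms.  Equality of maps is Leibniz
   equality. *)

Declare Scope map_scope.
Delimit Scope map_scope with map.
Local Open Scope map_scope.

Reserved Notation "g ∘ f" (at level 40, left associativity).
Reserved Notation "A × B" (at level 40, left associativity).
Reserved Notation "f ×m g" (at level 40, left associativity).
Reserved Notation "⟨ f , g ⟩" (at level 0, f at level 99, g at level 99).

Record category_data := Category {
  ob :> Type;
  hom : ob -> ob -> Type;
  idmap : forall A, hom A A;
  comp : forall A B C, hom B C -> hom A B -> hom A C }.

Arguments hom {_} A B.
Arguments idmap {_} A.
Arguments comp {_ A B C} g f.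
Notation "g ∘ f" := (comp g f) : map_scope.

Record is_category (C : category_data) : Prop := {
  comp_idl : forall (A B : C) (f : hom A B), idmap B ∘ f = f;
  comp_idr : forall (A B : C) (f : hom A B), f ∘ idmap A = f;
  comp_assoc : forall (A B A' B' : C)
      (h : hom A' B') (g : hom B A') (f : hom A B),
    h ∘ (g ∘ f) = h ∘ g ∘ f }.

Record endofunctor_data (C : category_data) := Endofunctor {
  fobj :> C -> C;
  fmap : forall A B : C, hom A B -> hom (fobj A) (fobj B) }.

Arguments fmap {C} F {A B} f : rename.

Record is_endofunctor (C : category_data) (F : endofunctor_data C) : Prop := {
  fmap_id : forall A : C, fmap F (idmap A) = idmap (F A);
  fmap_comp : forall (A B A' : C) (g : hom B A') (f : hom A B),
    fmap F (g ∘ f) = fmap F g ∘ fmap F f }.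

Class products (C : category_data) := Products {
  terminal : C;
  to_terminal : forall A : C, hom A terminal;
  product : C -> C -> C;
  pr0 : forall A B : C, hom (product A B) A;
  pr1 : forall A B : C, hom (product A B) B;
  pairing : forall A B A' : C, hom A B -> hom A A' -> hom A (product B A') }.

Arguments terminal {C _}.
Arguments to_terminal {C _} A.
Arguments product {C _} A B.
Arguments pr0 {C _ A B}.
Arguments pr1 {C _ A B}.
Arguments pairing {C _ A B A'} f g.
Notation "A × B" := (product A B) : map_scope.
Notation "⟨ f , g ⟩" := (pairing f g) : map_scope.

Record is_products (C : category_data) (P : products C) : Prop := {
  to_terminal_uniq : forall (A : C) (f : hom A terminal), f = to_terminal A;
  pr0_pairing : forall (A B A' : C) (f : hom A B) (g : hom A A'),
    pr0 ∘ ⟨f, g⟩ = f;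
  pr1_pairing : forall (A B A' : C) (f : hom A B) (g : hom A A'),
    pr1 ∘ ⟨f, g⟩ = g;
  pairing_uniq : forall (A B A' : C) (f : hom A B) (g : hom A A')
      (h : hom A (B × A')),
    pr0 ∘ h = f -> pr1 ∘ h = g -> h = ⟨f, g⟩ }.

Definition prod_map {C : category_data} {P : products C} {A B A' B' : C}
  (h : hom A A') (k : hom B B') : hom (A × B) (A' × B') :=
  ⟨h ∘ pr0, k ∘ pr1⟩.
Notation "f ×m g" := (prod_map f g) : map_scope.

Class left_additive (C : category_data) := LeftAdditive {
  add : forall A B : C, hom A B -> hom A B -> hom A B;
  zero : forall A B : C, hom A B }.

Arguments add {C _ A B} f g.
Arguments zero {C _ A B}.
Notation "f + g" := (add f g) : map_scope.
Notation "0" := zero : map_scope.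

Record is_left_additive (C : category_data) (L : left_additive C) : Prop := {
  add_assoc : forall (A B : C) (f g h : hom A B), f + (g + h) = f + g + h;
  add_comm : forall (A B : C) (f g : hom A B), f + g = g + f;
  add_0l : forall (A B : C) (f : hom A B), 0 + f = f;
  add_comp : forall (A B A' : C) (f g : hom B A') (x : hom A B),
    (f + g) ∘ x = f ∘ x + g ∘ x;
  zero_comp : forall (A B A' : C) (x : hom A B), (0 : hom B A') ∘ x = 0 }.

Definition additive {C : category_data} {L : left_additive C} {B A' : C}
  (f : hom B A') : Prop :=
  (forall (A : C) (x y : hom A B), f ∘ (x + y) = f ∘ x + f ∘ y) /\
  (forall A : C, f ∘ (0 : hom A B) = 0).

Record is_cartesian_left_additive
    (C : category_data) (P : products C) (L : left_additive C) : Prop := {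
  cla_category : is_category C;
  cla_products : is_products P;
  cla_left_additive : is_left_additive L;
  cla_pr0_additive : forall A B : C, additive (pr0 : hom (A × B) A);
  cla_pr1_additive : forall A B : C, additive (pr1 : hom (A × B) B) }.

Section CartesianLeftAdditiveMaps.
Context {C : category_data} {P : products C} {L : left_additive C}.

Definition iota0 {A B : C} : hom A (A × B) := ⟨idmap A, 0⟩.
Definition iota1 {A B : C} : hom B (A × B) := ⟨0, idmap B⟩.
Definition nabla (A : C) : hom (A × A) A := pr0 + pr1.
Definition ell (A : C) : hom (A × A) ((A × A) × (A × A)) := iota0 ×m iota1.
Definition exch (A : C) : hom ((A × A) × (A × A)) ((A × A) × (A × A)) :=
  ⟨pr0 ×m pr0, pr1 ×m pr1⟩.

End CartesianLeftAdditiveMaps.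

Definition differential_operator (C : category_data) {P : products C} :=
  forall A B : C, hom A B -> hom (A × A) B.
Arguments differential_operator C {P}.

Record is_differential_combinator (C : category_data) (P : products C)
    (L : left_additive C) (D : differential_operator C) : Prop := {
  CD1_add : forall (A B : C) (f g : hom A B), D _ _ (f + g) = D _ _ f + D _ _ g;
  CD1_zero : forall A B : C, D A B 0 = 0;
  CD2_add : forall (A B : C) (f : hom A B),
    D _ _ f ∘ (idmap A ×m nabla A)
    = D _ _ f ∘ (idmap A ×m pr0) + D _ _ f ∘ (idmap A ×m pr1);
  CD2_zero : forall (A B : C) (f : hom A B), D _ _ f ∘ iota0 = 0;
  CD3_id : forall A : C, D _ _ (idmap A) = pr1;
  CD3_pr0 : forall A B : C, D _ _ (pr0 : hom (A × B) A) = pr0 ∘ pr1;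
  CD3_pr1 : forall A B : C, D _ _ (pr1 : hom (A × B) B) = pr1 ∘ pr1;
  CD4 : forall (A B A' : C) (f : hom A B) (g : hom A A'),
    D _ _ ⟨f, g⟩ = ⟨D _ _ f, D _ _ g⟩;
  CD5 : forall (A B A' : C) (g : hom B A') (f : hom A B),
    D _ _ (g ∘ f) = D _ _ g ∘ ⟨f ∘ pr0, D _ _ f⟩;
  CD6 : forall (A B : C) (f : hom A B), D _ _ (D _ _ f) ∘ ell A = D _ _ f;
  CD7 : forall (A B : C) (f : hom A B),
    D _ _ (D _ _ f) ∘ exch A = D _ _ (D _ _ f) }.

Record is_cartesian_differential (C : category_data) (P : products C)
    (L : left_additive C) (D : differential_operator C) : Prop := {
  cd_cla : is_cartesian_left_additive P L;
  cd_combinator : is_differential_combinator L D }.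

Definition D_linear {C : category_data} {P : products C}
  (D : differential_operator C) {A B : C} (f : hom A B) : Prop :=
  D _ _ f = f ∘ pr1.

Record abstract_coKleisli_data (C : category_data) := AbstractCoKleisli {
  ack_bang :> endofunctor_data C;
  ack_phi : forall A : C, hom A (ack_bang A);
  ack_eps : forall A : C, hom (ack_bang A) A }.

Record is_abstract_coKleisli (C : category_data)
    (S : abstract_coKleisli_data C) : Prop := {
  ack_functor : is_endofunctor S;
  ack_phi_natural : forall (A B : C) (f : hom A B),
    fmap S f ∘ ack_phi S A = ack_phi S B ∘ f;
  ack_eps_bang_natural : forall (A B : C) (f : hom A B),
    ack_eps S (S B) ∘ fmap S (fmap S f) = fmap S f ∘ ack_eps S (S A);
  ack_eps_phi : forall A : C, ack_eps S A ∘ ack_phi S A = idmap A;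
  ack_eps_fmap_phi : forall A : C,
    ack_eps S (S A) ∘ fmap S (ack_phi S A) = idmap (S A);
  ack_eps_eps : forall A : C,
    ack_eps S A ∘ ack_eps S (S A) = ack_eps S A ∘ fmap S (ack_eps S A) }.

Definition eps_natural {C : category_data} (S : abstract_coKleisli_data C)
  {A B : C} (f : hom A B) : Prop :=
  ack_eps S B ∘ fmap S f = f ∘ ack_eps S A.

Record is_cartesian_left_additive_abstract_coKleisli (C : category_data)
    (P : products C) (L : left_additive C)
    (S : abstract_coKleisli_data C) : Prop := {
  clack_cla : is_cartesian_left_additive P L;
  clack_ack : is_abstract_coKleisli S;
  clack_pr0 : forall A B : C, eps_natural S (pr0 : hom (A × B) A);
  clack_pr1 : forall A B : C, eps_natural S (pr1 : hom (A × B) B);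
  clack_zero : forall A B : C, eps_natural S (0 : hom A B);
  clack_add : forall (A B : C) (f g : hom A B),
    eps_natural S f -> eps_natural S g -> eps_natural S (f + g) }.

Record is_cartesian_differential_abstract_coKleisli (C : category_data)
    (P : products C) (L : left_additive C) (D : differential_operator C)
    (S : abstract_coKleisli_data C) : Prop := {
  cdack_clack : is_cartesian_left_additive_abstract_coKleisli P L S;
  cdack_cd : is_cartesian_differential L D;
  cdack_D_linear : forall (A B : C) (f : hom A B),
    eps_natural S f -> D_linear D f }.

(* The terminal object doubles as the initial object, and A × B as the
   coproduct of A and B. *)
Class biproducts (C : category_data) := Biproducts {
  biproducts_products :: products C;
  from_terminal : forall A : C, hom terminal A;
  in0 : forall A B : C, hom A (A × B);
  in1 : forall A B : C, hom B (A × B);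
  copairing : forall A B A' : C, hom A A' -> hom B A' -> hom (A × B) A' }.

Arguments from_terminal {C _} A.
Arguments in0 {C _ A B}.
Arguments in1 {C _ A B}.
Arguments copairing {C _ A B A'} f g.

Definition zero_map {C : category_data} {B : biproducts C} (A A' : C) :
  hom A A' :=
  from_terminal A' ∘ to_terminal A.

Record is_biproducts (C : category_data) (B : biproducts C) : Prop := {
  biprod_products : is_products (biproducts_products (C := C));
  from_terminal_uniq : forall (A : C) (f : hom terminal A), f = from_terminal A;
  copairing_in0 : forall (A A1 A2 : C) (f : hom A1 A) (g : hom A2 A),
    copairing f g ∘ in0 = f;
  copairing_in1 : forall (A A1 A2 : C) (f : hom A1 A) (g : hom A2 A),
    copairing f g ∘ in1 = g;
  copairing_uniq : forall (A A1 A2 : C) (f : hom A1 A) (g : hom A2 A)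
      (h : hom (A1 × A2) A),
    h ∘ in0 = f -> h ∘ in1 = g -> h = copairing f g;
  pr0_in0 : forall A1 A2 : C, pr0 ∘ (in0 : hom A1 (A1 × A2)) = idmap A1;
  pr1_in1 : forall A1 A2 : C, pr1 ∘ (in1 : hom A2 (A1 × A2)) = idmap A2;
  pr0_in1 : forall A1 A2 : C,
    pr0 ∘ (in1 : hom A2 (A1 × A2)) = zero_map A2 A1;
  pr1_in0 : forall A1 A2 : C,
    pr1 ∘ (in0 : hom A1 (A1 × A2)) = zero_map A1 A2 }.

Record is_category_with_finite_biproducts (C : category_data)
    (B : biproducts C) : Prop := {
  cfb_category : is_category C;
  cfb_biproducts : is_biproducts B }.

(* f + g is the composite of ⟨f, g⟩ with the codiagonal. *)
#[export] Instance biproducts_left_additive (C : category_data)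
    (B : biproducts C) : left_additive C := {|
  add A A' f g := copairing (idmap A') (idmap A') ∘ ⟨f, g⟩;
  zero A A' := zero_map A A' |}.

(* A category with finite biproducts is Cartesian left additive, every map is
   additive, and the injections are the maps iota0 and iota1. *)
Section BiproductsFacts.
Context {C : category_data} {B : biproducts C}
  (HC : is_category_with_finite_biproducts B).

Let catC := cfb_category HC.
Let bipC := cfb_biproducts HC.
Let prodC := biprod_products bipC.

Lemma biproducts_pairing_comp (A A' B1 B2 : C) (f : hom A B1) (g : hom A B2)
  (x : hom A' A) : ⟨f, g⟩ ∘ x = ⟨f ∘ x, g ∘ x⟩.
Proof.
apply: (pairing_uniq prodC); rewrite (comp_assoc catC).
  by rewrite (pr0_pairing prodC).
by rewrite (pr1_pairing prodC).
Qed.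

Lemma biproducts_zero_comp (A A' A1 : C) (x : hom A A') :
  (0 : hom A' A1) ∘ x = 0.
Proof.
by rewrite /zero /= /zero_map -(comp_assoc catC) [_ ∘ x](to_terminal_uniq prodC).
Qed.

Lemma biproducts_comp_zero (A A' A1 : C) (x : hom A' A1) :
  x ∘ (0 : hom A A') = 0.
Proof.
by rewrite /zero /= /zero_map (comp_assoc catC) [x ∘ _](from_terminal_uniq bipC).
Qed.

Lemma biproducts_in0E (A A' : C) : in0 = iota0 :> hom A (A × A').
Proof. by apply: (pairing_uniq prodC); [apply: pr0_in0|apply: pr1_in0]. Qed.

Lemma biproducts_in1E (A A' : C) : in1 = iota1 :> hom A' (A × A').
Proof. by apply: (pairing_uniq prodC); [apply: pr0_in1|apply: pr1_in1]. Qed.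

Lemma biproducts_additive (B1 B2 : C) (f : hom B1 B2) : additive f.
Proof.
split=> [A x y|A]; last exact: biproducts_comp_zero.
have E : f ∘ copairing (idmap B1) (idmap B1)
       = copairing (idmap B2) (idmap B2) ∘ (f ×m f).
  rewrite [LHS](copairing_uniq bipC (f := f) (g := f)).
  - symmetry; apply: (copairing_uniq bipC); rewrite -(comp_assoc catC).
    + have -> : (f ×m f) ∘ in0 = in0 ∘ f.
        rewrite !biproducts_in0E /iota0 /prod_map !biproducts_pairing_comp.
        rewrite biproducts_zero_comp -!(comp_assoc catC) !(pr0_pairing prodC) !(pr1_pairing prodC).
        rewrite (comp_idl catC) (comp_idr catC).
        by rewrite biproducts_comp_zero.
      by rewrite (comp_assoc catC) (copairing_in0 bipC) (comp_idl catC).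
    + have -> : (f ×m f) ∘ in1 = in1 ∘ f.
        rewrite !biproducts_in1E /iota1 /prod_map !biproducts_pairing_comp.
        rewrite biproducts_zero_comp -!(comp_assoc catC) !(pr0_pairing prodC) !(pr1_pairing prodC).
        rewrite (comp_idl catC) (comp_idr catC).
        by rewrite biproducts_comp_zero.
      by rewrite (comp_assoc catC) (copairing_in1 bipC) (comp_idl catC).
  - by rewrite -(comp_assoc catC) (copairing_in0 bipC) (comp_idr catC).
  - by rewrite -(comp_assoc catC) (copairing_in1 bipC) (comp_idr catC).
rewrite /add /= (comp_assoc catC) E -(comp_assoc catC).
rewrite /prod_map biproducts_pairing_comp -!(comp_assoc catC).
by rewrite (pr0_pairing prodC) (pr1_pairing prodC).
Qed.

Lemma biproducts_cartesian_left_additive :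
  is_cartesian_left_additive (biproducts_products (C := C))
    (biproducts_left_additive B).
Proof.
have add_c (A B1 B2 : C) (f g : hom B1 B2) (x : hom A B1) :
    (f + g) ∘ x = f ∘ x + g ∘ x.
  by rewrite /add /= -(comp_assoc catC) biproducts_pairing_comp.
have addr0 (A B1 : C) (f : hom A B1) : f + 0 = f.
  have -> : f + 0 = copairing (idmap _) (idmap _) ∘ (in0 ∘ f).
    rewrite biproducts_in0E /iota0 biproducts_pairing_comp (comp_idl catC).
    by rewrite biproducts_zero_comp.
  by rewrite (comp_assoc catC) (copairing_in0 bipC) (comp_idl catC).
have add0r (A B1 : C) (f : hom A B1) : 0 + f = f.
  have -> : 0 + f = copairing (idmap _) (idmap _) ∘ (in1 ∘ f).
    rewrite biproducts_in1E /iota1 biproducts_pairing_comp (comp_idl catC).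
    by rewrite biproducts_zero_comp.
  by rewrite (comp_assoc catC) (copairing_in1 bipC) (comp_idl catC).
have pairD (A B1 : C) (a b c d : hom A B1) : ⟨a, b⟩ + ⟨c, d⟩ = ⟨a + c, b + d⟩.
  apply: (pairing_uniq prodC); rewrite (proj1 (biproducts_additive _)).
    by rewrite !(pr0_pairing prodC).
  by rewrite !(pr1_pairing prodC).
have addACA (A B1 : C) (a b c d : hom A B1) : (a + b) + (c + d) = (a + c) + (b + d).
  rewrite [RHS]/add /= -/(add a c) -/(add b d) -pairD.
  by rewrite (proj1 (biproducts_additive _)).
split=> //; [split=> // | by move=> *; apply: biproducts_additive ..].
- by move=> A B1 f g h; rewrite -{1}[f]addr0 addACA add0r.
- by move=> A B1 f g; rewrite -{1}[f]add0r -{1}[g]addr0 addACA add0r addr0.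
- by move=> *; apply: biproducts_zero_comp.
Qed.

End BiproductsFacts.

Record comonad_data (C : category_data) := Comonad {
  bang :> endofunctor_data C;
  delta : forall A : C, hom (bang A) (bang (bang A));
  eps : forall A : C, hom (bang A) A }.

Record is_comonad (C : category_data) (M : comonad_data C) : Prop := {
  comonad_functor : is_endofunctor M;
  delta_natural : forall (A B : C) (f : hom A B),
    fmap M (fmap M f) ∘ delta M A = delta M B ∘ fmap M f;
  eps_natural_comonad : forall (A B : C) (f : hom A B),
    f ∘ eps M A = eps M B ∘ fmap M f;
  eps_delta : forall A : C, eps M (M A) ∘ delta M A = idmap (M A);
  fmap_eps_delta : forall A : C, fmap M (eps M A) ∘ delta M A = idmap (M A);
  delta_delta : forall A : C,
    delta M (M A) ∘ delta M A = fmap M (delta M A) ∘ delta M A }.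

Definition coKleisli (X : category_data) (M : comonad_data X) : category_data := {|
  ob := ob X;
  hom A B := hom (M A) B;
  idmap A := eps M A;
  comp A B C g f := g ∘ fmap M f ∘ delta M A |}.

Definition coKleisli_products (X : category_data) (P : products X)
    (M : comonad_data X) : products (coKleisli M) := {|
  terminal := @terminal X P : coKleisli M;
  to_terminal A := @to_terminal X P (M A);
  product A B := @product X P A B;
  pr0 A B := pr0 ∘ eps M (@product X P A B);
  pr1 A B := pr1 ∘ eps M (@product X P A B);
  pairing A B A' f g := @pairing X P (M A) B A' f g |}.

Definition coKleisli_left_additive (X : category_data) (L : left_additive X)
    (M : comonad_data X) : left_additive (coKleisli M) := {|
  add (A B : coKleisli M) f g := @add X L (M A) B f g;
  zero A B := @zero X L (M A) B |}.

Definition coKleisli_abstract_coKleisli (X : category_data)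
    (M : comonad_data X) : abstract_coKleisli_data (coKleisli M) := {|
  ack_bang := {|
    fobj (A : coKleisli M) := M A : coKleisli M;
    fmap A B f := @fmap X M (M A) B f ∘ delta M A ∘ eps M (M A) |};
  ack_phi A := idmap (M A);
  ack_eps A := eps M A ∘ eps M (M A) |}.

Definition differential_transformation (X : category_data) {P : products X}
    (M : comonad_data X) :=
  forall A : X, hom (M (A × A)) (M A).

Record is_differential_combinator_transformation (X : category_data)
    (B : biproducts X) (M : comonad_data X)
    (d : differential_transformation M) : Prop := {
  dc_natural : forall (A A' : X) (f : hom A A'),
    d A' ∘ fmap M (f ×m f) = fmap M f ∘ d A;
  dc1 : forall A : X, d A ∘ fmap M iota0 = 0;
  dc2 : forall A : X,
    d A ∘ fmap M (idmap A ×m nabla A)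
    = d A ∘ (fmap M (idmap A ×m pr0) + fmap M (idmap A ×m pr1));
  dc3 : forall A : X, eps M A ∘ d A = pr1 ∘ eps M (A × A);
  dc4 : forall A : X,
    delta M A ∘ d A = d (M A) ∘ fmap M ⟨fmap M pr0, d A⟩ ∘ delta M (A × A);
  dc5 : forall A : X, d A ∘ d (A × A) ∘ fmap M (ell A) = d A;
  dc6 : forall A : X,
    d A ∘ d (A × A) ∘ fmap M (exch A) = d A ∘ d (A × A) }.

Record is_cartesian_differential_comonad (X : category_data)
    (B : biproducts X) (M : comonad_data X)
    (d : differential_transformation M) : Prop := {
  cdcomonad_category : is_category_with_finite_biproducts B;
  cdcomonad_comonad : is_comonad M;
  cdcomonad_transformation : is_differential_combinator_transformation d }.

Definition coKleisli_differential (X : category_data) (P : products X)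
    (M : comonad_data X) (d : differential_transformation M) :
    @differential_operator (coKleisli M) (coKleisli_products P M) :=
  fun A B f => @comp X _ (M A) B f (d A).

(* Main.v *)
Require Import Defs.
From mathcomp Require Import ssreflect.

Set Implicit Arguments.
Unset Strict Implicit.
Unset Printing Implicit Defensive.

(** Call the coKleisli map [x ∘ ε : !A -> A'] the lift of the map
    [x : A -> A'] of the base category [X].  Composing with lifts is easy: [g]
    after the lift of [x] is [g ∘ !x], and the lift of [x] after [f] is [x ∘ f]
    (lemmas [comp_lift] and [lift_comp]).  Apart from [φ] and the pairings, the
    structural maps of the coKleisli category are lifts: its projections,
    [iota0], [nabla], [ell] and [exch] lift those of [X], the map [!(f)] lifts
    [!f ∘ δ], and [ϵ] lifts [ε].  Hence the axioms become equations of [X]: the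
    abstract coKleisli axioms become comonad identities, and the differential
    axioms [CD2], [CD3], [CD6], [CD7] become [dc1], [dc2], [dc3], [dc5], [dc6],
    composed on the left with a map of [X].  [CD1] and [CD4] say that
    precomposition by [∂] preserves sums, zero and pairings.

    Two facts need an argument.  The chain rule [CD5] (lemma [chain_rule])
    combines [dc4], which moves [∂] past [δ], with naturality of [∂], which
    moves it past [!f].  The D-linearity of ϵ-natural maps (lemma
    [eps_natural_derivative]) comes from [dc3] at the object [!A]: an ϵ-natural
    [f] is a map with [f ∘ ε = f ∘ !ε], so [f ∘ ∂], once pulled back along
    [!(ε × ε)], turns into [f ∘ ε ∘ ∂], which [dc3] computes; and [!(ε × ε)]
    is a split epimorphism. *)

Local Open Scope map_scope.

Section CoKleisli.
Context (X : category_data) (B : biproducts X) (M : comonad_data X)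
  (d : differential_transformation M) (Hd : is_cartesian_differential_comonad d).

Let HX := cdcomonad_category Hd.
Let catX := cfb_category HX.
Let prodX := biprod_products (cfb_biproducts HX).
Let claX := biproducts_cartesian_left_additive HX.
Let laX := cla_left_additive claX.
Let comM := cdcomonad_comonad Hd.
Let functM := comonad_functor comM.
Let trX := cdcomonad_transformation Hd.
Let cA := comp_assoc catX.
Let pairing_comp := @biproducts_pairing_comp X B HX.

Local Notation "! f" := (fmap M f) (at level 9, right associativity).
Local Notation ε := (eps M _).
Local Notation δ := (delta M _).
Local Notation ck := (coKleisli M).
Local Notation ckP := (coKleisli_products (@biproducts_products X B) M).
Local Notation ckL := (coKleisli_left_additive (biproducts_left_additive B) M).
Local Notation ckD := (coKleisli_differential d).
Local Notation ckS := (coKleisli_abstract_coKleisli M).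

Lemma fmap_compose (A A' A'' : X) (g : hom A' A'') (f : hom A A') :
  !(g ∘ f) = !g ∘ !f.
Proof. exact: fmap_comp functM _ _ _ g f. Qed.

Lemma comp_distr (A A' A'' : X) (h : hom A' A'') (f g : hom A A') :
  h ∘ (f + g) = h ∘ f + h ∘ g.
Proof. exact: (proj1 (biproducts_additive HX h)). Qed.

(** * Composition with lifts *)

Lemma coext_lift (A A' : X) (x : hom A A') : !(x ∘ ε) ∘ δ = !x.
Proof.
by rewrite fmap_compose -cA (fmap_eps_delta comM) (comp_idr catX).
Qed.

Lemma comp_lift (A A' A'' : X) (g : hom (M A') A'') (x : hom A A') :
  g ∘ !(x ∘ ε) ∘ δ = g ∘ !x.
Proof. by rewrite -cA coext_lift. Qed.

Lemma eps_coext (A A' : X) (f : hom (M A) A') : ε ∘ (!f ∘ δ) = f.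
Proof.
by rewrite cA -(eps_natural_comonad comM) -cA (eps_delta comM) (comp_idr catX).
Qed.

Lemma lift_comp (A A' A'' : X) (x : hom A' A'') (f : hom (M A) A') :
  x ∘ ε ∘ !f ∘ δ = x ∘ f.
Proof. by rewrite -!cA eps_coext. Qed.

(** By naturality of [δ] and [delta_delta], [f |-> !f ∘ δ] is functorial from
    the coKleisli category to [X]; associativity of coKleisli composition and
    functoriality of [!] on coKleisli maps both reduce to this. *)
Lemma coext_comp (A A' A'' : X) (g : hom (M A') A'') (f : hom (M A) A') :
  !(g ∘ !f ∘ δ) ∘ δ = !g ∘ δ ∘ (!f ∘ δ).
Proof.
rewrite !fmap_compose -!cA; congr (_ ∘ _).
by rewrite [δ ∘ (_ ∘ _)]cA -(delta_natural comM) -cA (delta_delta comM).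
Qed.

Lemma coKleisli_category : is_category ck.
Proof.
split=> /=.
- by move=> A A' f; rewrite -cA eps_coext.
- move=> A A' f; rewrite -cA (fmap_eps_delta comM).
  exact: comp_idr.
- move=> A A1 A2 A3 h g f.
  by rewrite -cA coext_comp !cA.
Qed.

Lemma coKleisli_is_products : is_products ckP.
Proof.
split=> /=.
- by move=> A f; apply: (to_terminal_uniq prodX).
- by move=> A A1 A2 f g; rewrite lift_comp (pr0_pairing prodX).
- by move=> A A1 A2 f g; rewrite lift_comp (pr1_pairing prodX).
- move=> A A1 A2 f g h; rewrite !lift_comp.
  exact: (pairing_uniq prodX).
Qed.

Lemma coKleisli_is_left_additive : is_left_additive ckL.
Proof.
split.
- by move=> A A' f g h; apply: (add_assoc laX).
- by move=> A A' f g; apply: (add_comm laX).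
- by move=> A A' f; apply: (add_0l laX).
- by move=> A A1 A2 f g x; rewrite /comp [LHS]/= !(add_comp laX).
- by move=> A A1 A2 x; rewrite /comp [LHS]/= !(zero_comp laX).
Qed.

Lemma lift_additive (A A' : X) (x : hom A A') :
  @additive ck ckL A A' (x ∘ ε).
Proof.
split=> [A1 f g|A1]; rewrite /comp /= !lift_comp.
  exact: comp_distr.
exact: (biproducts_comp_zero HX).
Qed.

Lemma coKleisli_cartesian_left_additive : is_cartesian_left_additive ckP ckL.
Proof.
split.
- exact: coKleisli_category.
- exact: coKleisli_is_products.
- exact: coKleisli_is_left_additive.
- by move=> *; apply: lift_additive.
- by move=> *; apply: lift_additive.
Qed.

(** * The abstract coKleisli structure *)

Lemma coKleisli_is_abstract_coKleisli : is_abstract_coKleisli ckS.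
Proof.
split=> /=; last 5 first.
- move=> A A' f.
  by rewrite lift_comp (comp_idl catX) (comp_idr catX).
- move=> A A' f.
  by rewrite !lift_comp coext_lift !cA -(eps_natural_comonad comM).
- by move=> A; rewrite lift_comp (comp_idr catX).
- move=> A.
  by rewrite lift_comp (fmap_id functM) (comp_idl catX) cA (eps_delta comM)
    (comp_idl catX).
- move=> A.
  rewrite !lift_comp coext_lift !cA; congr (_ ∘ _).
  exact: (eps_natural_comonad comM).
split=> /=.
- by move=> A; rewrite (fmap_eps_delta comM) (comp_idl catX).
- move=> A A1 A2 g f.
  by rewrite lift_comp coext_comp !cA.
Qed.

(** Both composites with [ϵ] simplify because [ϵ_A] is the lift of [ε_A], and
    [!(f)] the lift of [!f ∘ δ], which [ε] sends back to [f]. *)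
Lemma eps_naturalP (A A' : X) (f : hom (M A) A') :
  @eps_natural ck ckS A A' f <-> f ∘ ε = f ∘ !ε.
Proof. by rewrite /eps_natural /= lift_comp comp_lift cA eps_coext. Qed.

Lemma lift_eps_natural (A A' : X) (x : hom A A') :
  @eps_natural ck ckS A A' (x ∘ ε).
Proof. by apply/eps_naturalP; rewrite -!cA (eps_natural_comonad comM). Qed.

Lemma coKleisli_cartesian_left_additive_abstract_coKleisli :
  is_cartesian_left_additive_abstract_coKleisli ckP ckL ckS.
Proof.
split.
- exact: coKleisli_cartesian_left_additive.
- exact: coKleisli_is_abstract_coKleisli.
- by move=> *; apply: lift_eps_natural.
- by move=> *; apply: lift_eps_natural.
- by move=> A A'; apply/eps_naturalP; rewrite !(zero_comp laX).
- move=> A A' f g /eps_naturalP Ef /eps_naturalP Eg; apply/eps_naturalP.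
  by rewrite !(add_comp laX) Ef Eg.
Qed.

(** * The differential combinator *)

(** Together with the next lemmas, this lets [comp_lift] turn the
    precompositions in [CD2], [CD6] and [CD7] into precompositions by [!] of
    the corresponding maps of [X]. *)
Lemma coKleisli_prod_map_lift (A A' A1 A1' : X) (x : hom A A') (y : hom A1 A1') :
  @prod_map ck ckP A A1 A' A1' (x ∘ ε) (y ∘ ε) = (x ×m y) ∘ ε.
Proof.
by rewrite /prod_map /= !comp_lift pairing_comp -!cA -!(eps_natural_comonad comM).
Qed.

Lemma coKleisli_id_prod_map_lift (A A1 A1' : X) (y : hom A1 A1') :
  @prod_map ck ckP A A1 A A1' (idmap (A : ck)) (y ∘ ε) = (idmap A ×m y) ∘ ε.
Proof. by rewrite -coKleisli_prod_map_lift (comp_idl catX). Qed.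

Lemma coKleisli_iota0 (A A' : X) : @iota0 ck ckP ckL A A' = iota0 ∘ ε.
Proof. by rewrite /iota0 pairing_comp (comp_idl catX) (zero_comp laX). Qed.

Lemma coKleisli_iota1 (A A' : X) : @iota1 ck ckP ckL A A' = iota1 ∘ ε.
Proof. by rewrite /iota1 pairing_comp (comp_idl catX) (zero_comp laX). Qed.

Lemma coKleisli_nabla (A : X) : @nabla ck ckP ckL A = nabla A ∘ ε.
Proof. by rewrite /nabla (add_comp laX). Qed.

Lemma coKleisli_ell (A : X) : @ell ck ckP ckL A = ell A ∘ ε.
Proof. by rewrite /ell coKleisli_iota0 coKleisli_iota1 coKleisli_prod_map_lift. Qed.

Lemma coKleisli_exch (A : X) : @exch ck ckP A = exch A ∘ ε.
Proof. by rewrite /exch !coKleisli_prod_map_lift pairing_comp. Qed.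

(** Moving [∂] to the left past [δ] ([dc4]) leaves the correction
    [!⟨!π0, ∂⟩]; moving it past [!f] leaves [!(f × f)], which merges with that
    correction into the pairing of [f ∘ !π0] and [f ∘ ∂]. *)
Lemma chain_rule (A A' A'' : X) (g : hom (M A') A'') (f : hom (M A) A') :
  g ∘ !f ∘ δ ∘ d A = g ∘ d A' ∘ !⟨f ∘ !pr0, f ∘ d A⟩ ∘ δ.
Proof.
have -> : ⟨f ∘ !pr0, f ∘ d A⟩ = (f ×m f) ∘ ⟨!pr0, d A⟩.
  by rewrite /prod_map pairing_comp -!cA (pr0_pairing prodX) (pr1_pairing prodX).
by rewrite fmap_compose -!cA (dc4 trX) [d A' ∘ _]cA (dc_natural trX) -!cA.
Qed.

(** [f ∘ ∂ ∘ !(ε × ε) = f ∘ !ε ∘ ∂ = f ∘ ε ∘ ∂ = f ∘ π1 ∘ ε] by naturality of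
    [∂], the hypothesis and [dc3] at [!A].  This determines [f ∘ ∂], since
    [!(ε × ε)] has the section [!⟨!π0, !π1⟩ ∘ δ]. *)
Lemma eps_natural_derivative (A A' : X) (f : hom (M A) A') :
  f ∘ ε = f ∘ !ε -> f ∘ d A = f ∘ !pr1.
Proof.
move=> Ef.
have E : f ∘ d A ∘ !(ε ×m ε) = f ∘ pr1 ∘ ε.
  by rewrite -cA (dc_natural trX) cA -Ef -cA (dc3 trX) cA.
have section : !(ε ×m ε) ∘ (!⟨!pr0, !pr1⟩ ∘ δ) = idmap (M (A × A)).
  rewrite cA -fmap_compose /prod_map pairing_comp -!cA.
  rewrite (pr0_pairing prodX) (pr1_pairing prodX) -!(eps_natural_comonad comM).
  rewrite -(pairing_uniq prodX (h := eps M (A × A)) (eq_refl _) (eq_refl _)).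
  exact: fmap_eps_delta.
rewrite -[LHS](comp_idr catX) -section cA E.
by rewrite -cA eps_coext -cA (pr1_pairing prodX).
Qed.

Lemma coKleisli_is_differential_combinator : is_differential_combinator ckL ckD.
Proof.
split; rewrite /coKleisli_differential.
- by move=> A A' f g; rewrite (add_comp laX).
- by move=> A A'; rewrite (zero_comp laX).
- move=> A A' f; rewrite coKleisli_nabla !coKleisli_id_prod_map_lift /=.
  by rewrite !comp_lift -!cA (dc2 trX) !comp_distr.
- move=> A A' f; rewrite coKleisli_iota0 /= comp_lift -cA (dc1 trX).
  exact: (biproducts_comp_zero HX).
- by move=> A; apply: (dc3 trX).
- by move=> A A' /=; rewrite comp_lift -!cA (dc3 trX) (eps_natural_comonad comM).
- by move=> A A' /=; rewrite comp_lift -!cA (dc3 trX) (eps_natural_comonad comM).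
- by move=> A A1 A2 f g /=; rewrite pairing_comp.
- by move=> A A1 A2 g f /=; rewrite comp_lift chain_rule.
- by move=> A A' f; rewrite coKleisli_ell /= comp_lift -!cA [d A ∘ _]cA (dc5 trX).
- by move=> A A' f; rewrite coKleisli_exch /= comp_lift -!cA [d A ∘ _]cA (dc6 trX).
Qed.

End CoKleisli.

Theorem proposition4p16 (X : category_data) (B : biproducts X)
    (M : comonad_data X) (d : differential_transformation M) :
  is_cartesian_differential_comonad d ->
  @is_cartesian_differential_abstract_coKleisli (coKleisli M)
    (coKleisli_products (@biproducts_products X B) M)
    (coKleisli_left_additive (biproducts_left_additive B) M)
    (coKleisli_differential d)
    (coKleisli_abstract_coKleisli M).
Proof.
move=> Hd; split.
- exact: (coKleisli_cartesian_left_additive_abstract_coKleisli Hd).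
- split; first exact: (coKleisli_cartesian_left_additive Hd).
  exact: (coKleisli_is_differential_combinator Hd).
- move=> A A' f /(eps_naturalP Hd) Ef.
  by rewrite /D_linear /= (comp_lift Hd); apply: (eps_natural_derivative Hd).
Qed.
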